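(* For any integer $n > 1$ there are real numbers $\alpha_1,\ldots,\alpha_n$ and continuous functions $\varphi_1,\varphi_2,\ldots,\varphi_{2n+1}\colon [0,1]\to[0,1]$ such that for any continuous function $f\colon [0,1]^n\to\mathbb{R}$ there is a continuous function $h\colon\mathbb{R}\to\mathbb{R}$ such that for all $x_1,\ldots,x_n\in[0,1]$ \[ f(x_1,\ldots,x_n)=\sum_{k=1}^{2n+1} h\left(\sum_{i=1}^n \alpha_i\,\varphi_k(x_i)\right). \] *)

(* Defs.v *)
From mathcomp Require Export all_boot all_order all_algebra.
From mathcomp Require Export all_classical all_reals all_analysis.

Set Implicit Arguments.
Unset Strict Implicit.
Unset Printing Implicit Defensive.

Export Order.TTheory GRing.Theory Num.Theory.
Export numFieldNormedType.Exports.

#[global] Open Scope classical_set_scope.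
#[global] Open Scope ring_scope.

Definition unit_cube (R : realType) (n : nat) : set 'rV[R]_n :=
  [set x | forall i : 'I_n, `[0, 1]%classic (x ord0 i)].
Arguments unit_cube : clear implicits.

(* Main.v *)
Require Import Defs.
From mathcomp Require Import ring lra zify.

Set Implicit Arguments.
Unset Strict Implicit.
Unset Printing Implicit Defensive.

(** The outer function [h] is the sum of a series.  It suffices that, for some
    fixed [theta < 1], every continuous [f] with [|f| <= M] on the cube is within
    [theta * M] of some [sum_k g (Phi_k x)] with [|g| <= M / (n + 1)], where
    [Phi_k x = sum_i alpha_i phi_k(x_i)]; one then iterates on the remainder.

    For such a [g] at a given scale, cover [[0, 1]] by [2n + 1] families of short
    intervals so that each point is missed by at most one family.  Then each [x]
    of the cube lies in a product cell for at least [n + 1] values of [k].  If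
    [phi_k] is constant on the intervals of family [k], with distinct rational
    values over all intervals of all families, and [alpha_i = t ^ i] with [t]
    transcendental, then the values of [Phi_k] on the cells are pairwise distinct,
    and one prescribes [g = f / (n + 1)] there.  This survives a small perturbation
    of the [phi_k], so the scales can be handled successively, shrinking the
    allowed perturbation at each stage and passing to the limit. *)

(** * Limits of nested approximations *)

(** The intervals of centre [H m x] and radius [r m] are nested, so the supremum of their left ends
    lies in all of them. This produces both the inner functions and the outer function. *)
Lemma nested_limit (R : realType) (T : Type) (H : nat -> T -> R) (r : nat -> R) :
  (forall m, 0 <= r m) ->
  (forall m x, `|H m.+1 x - H m x| + r m.+1 <= r m) ->
  exists h : T -> R, forall m x, `|h x - H m x| <= r m.
Proof.
move=> r0 Hr.
have lo m d x : H m x - r m <= H (m + d)%N x - r (m + d)%N.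
  elim: d => [|d IH]; first by rewrite addn0.
  apply: le_trans IH _; rewrite addnS.
  by have := Hr (m + d)%N x; rewrite addrC -lerBrDl ler_norml => /andP[]; lra.
have up m d x : H (m + d)%N x + r (m + d)%N <= H m x + r m.
  elim: d => [|d IH]; first by rewrite addn0.
  apply: le_trans _ IH; rewrite addnS.
  by have := Hr (m + d)%N x; rewrite addrC -lerBrDl ler_norml => /andP[]; lra.
have lu m l x : H m x - r m <= H l x + r l.
  have := lo m l x; have := up l m x; have := r0 (m + l)%N.
  by rewrite (addnC l); lra.
exists (fun x => sup (range (fun m => H m x - r m))) => m x.
have ub : ubound (range (fun m => H m x - r m)) (H m x + r m).
  by move=> _ [l _ <-]; exact: lu.
have h1 : sup (range (fun m => H m x - r m)) <= H m x + r m.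
  by apply: ge_sup ub; exists (H 0 x - r 0); exists 0.
have h2 : H m x - r m <= sup (range (fun m => H m x - r m)).
  by apply: ub_le_sup; [exists (H m x + r m)|exists m].
by rewrite ler_norml; apply/andP; split; lra.
Qed.

Lemma uniform_approx_continuous (R : realType) (T : topologicalType)
    (H : nat -> T -> R) (r : nat -> R) (h : T -> R) :
  (forall m, continuous (H m)) -> (forall m x, `|h x - H m x| <= r m) ->
  (forall e, 0 < e -> exists m, r m <= e) -> continuous h.
Proof.
move=> Hc hH rc x; apply/cvgrPdist_lt => e e0.
have [|m rm] := rc (e / 4); first by rewrite divr_gt0.
have /cvgrPdist_lt /(_ (e / 4)) := Hc m x.
rewrite divr_gt0 // => /(_ isT); apply: filterS => y Hxy.
rewrite (_ : h x - h y = (h x - H m x) + (H m x - H m y) - (h y - H m y)); last by ring.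
apply: le_lt_trans (ler_normB _ _) _; apply: le_lt_trans (lerD (ler_normD _ _) (lexx _)) _.
by have := hH m x; have := hH m y; lra.
Qed.

(** * Clamping to the unit interval, and Lipschitz functions *)

Definition clamp01 (R : realType) (t : R) : R := Num.max 0 (Num.min 1 t).

Section Clamp.
Variable R : realType.
Implicit Types s t : R.

Lemma clamp01_itv t : 0 <= clamp01 t <= 1.
Proof. by rewrite /clamp01 le_max lexx ge_max ler01 ge_min lexx. Qed.

Lemma clamp01_id t : 0 <= t <= 1 -> clamp01 t = t.
Proof. by move=> /andP[t0 t1]; rewrite /clamp01 (min_idPr t1) (max_idPr t0). Qed.

Lemma clamp01_ge1 t : 1 <= t -> clamp01 t = 1.
Proof. by move=> t1; rewrite /clamp01 (min_idPl t1) (max_idPr ler01). Qed.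

Lemma clamp01_le0 t : t <= 0 -> clamp01 t = 0.
Proof.
move=> t0; rewrite /clamp01 (min_idPr (le_trans t0 ler01)); exact/max_idPl.
Qed.

Lemma clamp01_le s t : s <= t -> clamp01 s <= clamp01 t.
Proof.
move=> st; case: (leP s 0) => [/clamp01_le0 ->|s0].
  by have /andP[] := clamp01_itv t.
case: (leP 1 t) => [/clamp01_ge1 ->|t1]; first by have /andP[] := clamp01_itv s.
by rewrite !clamp01_id //; lra.
Qed.

Lemma clamp01_lip s t : `|clamp01 s - clamp01 t| <= `|s - t|.
Proof.
wlog st : s t / s <= t.
  by move=> W; case: (leP s t) => [|/ltW] /W //; rewrite distrC (distrC s).
have := clamp01_le st; rewrite -subr_le0 => /ler0_norm ->.
rewrite ler0_norm ?subr_le0 //.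
case: (leP s 0) => s0; case: (leP 1 t) => t1.
- by rewrite (clamp01_le0 s0) (clamp01_ge1 t1); lra.
- rewrite (clamp01_le0 s0); case: (leP t 0) => t0; first by rewrite clamp01_le0 //; lra.
  by rewrite clamp01_id; lra.
- rewrite (clamp01_ge1 t1); case: (leP 1 s) => s1; first by rewrite clamp01_ge1 //; lra.
  by rewrite clamp01_id; lra.
- by rewrite !clamp01_id; lra.
Qed.

End Clamp.

(** A class closed under the operations that build piecewise linear functions; its explicit modulus
    also determines how fine a mesh each stage needs. *)
Definition lipschitz (R : realType) (f : R -> R) :=
  exists L, 0 <= L /\ forall x y, `|f x - f y| <= L * `|x - y|.

Section Lipschitz.
Variable R : realType.
Implicit Types f g : R -> R.

Lemma lipschitz_continuous f : lipschitz f -> continuous f.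
Proof.
move=> [L [L0 fL]] x; apply/cvgrPdist_lt => e e0; near=> y.
apply: le_lt_trans (fL _ _) _.
have : `|x - y| < e / (L + 1).
  near: y; apply: cvgr_dist_lt => //; rewrite divr_gt0 //; lra.
rewrite ltr_pdivlMr; last lra.
by have := normr_ge0 (x - y); lra.
Unshelve. all: end_near.
Qed.

Lemma lipschitz_cst c : lipschitz (fun=> c : R).
Proof. by exists 0; split=> // x y; rewrite subrr normr0 mul0r. Qed.

Lemma lipschitz_affine (a b : R) : lipschitz (fun x => a * x + b).
Proof.
exists `|a|; split=> // x y; rewrite -normrM.
by rewrite (_ : a * x + b - _ = a * (x - y)) //; ring.
Qed.

Lemma lipschitz_norm : lipschitz (fun x : R => `|x|).
Proof. by exists 1; split=> // x y; rewrite mul1r ler_dist_dist. Qed.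

Lemma lipschitz_clamp01 : lipschitz (@clamp01 R).
Proof. by exists 1; split=> // x y; rewrite mul1r clamp01_lip. Qed.

Lemma lipschitz_comp f g : lipschitz f -> lipschitz g -> lipschitz (fun x => f (g x)).
Proof.
move=> [L [L0 fL]] [M [M0 gM]]; exists (L * M); split; first exact: mulr_ge0.
move=> x y; apply: le_trans (fL _ _) _; rewrite -mulrA; exact: ler_wpM2l.
Qed.

Lemma lipschitzD f g : lipschitz f -> lipschitz g -> lipschitz (fun x => f x + g x).
Proof.
move=> [L [L0 fL]] [M [M0 gM]]; exists (L + M); split; first exact: addr_ge0.
move=> x y; rewrite (_ : f x + g x - _ = (f x - f y) + (g x - g y)); last by ring.
by apply: le_trans (ler_normD _ _) _; rewrite mulrDl lerD.
Qed.

Lemma lipschitzZ c f : lipschitz f -> lipschitz (fun x => c * f x).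
Proof.
move=> fl; have := lipschitz_comp (lipschitz_affine c 0) fl.
by under [X in lipschitz X -> _]eq_fun do rewrite addr0.
Qed.

Lemma lipschitz_sum (I : finType) (F : I -> R -> R) :
  (forall i, lipschitz (F i)) -> lipschitz (fun x => \sum_i F i x).
Proof.
move=> Fl; elim: (index_enum I) => [|i s IH].
  by under eq_fun do rewrite big_nil; exact: lipschitz_cst.
by under eq_fun do rewrite big_cons; exact: lipschitzD.
Qed.

End Lipschitz.

(** * Existence of a transcendental number *)

(** The roots of the countably many nonzero integer polynomials form a countable set, hence a
    Lebesgue null set, whereas the line has measure at least 1. *)
Lemma exists_transcendental (R : realType) :
  exists t : R, forall p : {poly int}, (map_poly intr p).[t] = 0 -> p = 0.
Proof.
(* The zero polynomial vanishes everywhere, so it gets the empty set instead of its roots. *)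
pose Z (p : {poly int}) : set R :=
  if p == 0 then set0 else [set t | (map_poly intr p).[t] = 0].
have Zc p : countable (Z p).
  rewrite /Z; case: eqVneq => [_|p0]; first exact: countable0.
  have q0 : map_poly intr p != 0 :> {poly R}.
    by rewrite map_poly_eq0_id0 // intr_eq0 lead_coef_eq0.
  apply: finite_set_countable.
  apply: contrapT => /(@infinite_set_fset R _ (size (map_poly intr p : {poly R}))).
  move=> [B BZ Bs]; apply/negP: q0; rewrite negbK; apply/eqP.
  apply: roots_geq_poly_eq0 Bs; last exact: finmap.fset_uniq.
  by apply/allP => t tB; apply/rootP; exact: (BZ t).
have Zct : countable (\bigcup_(p in setT) Z p).
  by apply: bigcup_countable => //; exact: countableP.
have [t Zt] : exists t, ~ (\bigcup_(p in setT) Z p) t.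
  apply: contrapT => nt.
  have ZT : \bigcup_(p in setT) Z p = setT.
    by apply/seteqP; split=> // t _; apply: contrapT => h; apply: nt; exists t.
  have := countable_lebesgue_measure0 Zct; rewrite ZT => T0.
  have : (lebesgue_measure (`[0%R, 1%R]%classic : set R) <= lebesgue_measure (setT : set R))%E.
    by apply: le_measure; rewrite ?inE //; exact: measurable_itv.
  by rewrite T0 lebesgue_measure_itv /= lte_fin ltr01 oppr0 adde0 lee_fin ler10.
exists t => p pt; apply: contrapT => /eqP p0; apply: Zt; exists p => //.
by rewrite /Z (negbTE p0).
Qed.

(** * Distinct values, separation and interpolation *)

(** The factor 4 makes bumps of radius [2 * rho] around the values disjoint. *)
Lemma separated_family (R : realType) (T : finType) (v : T -> R) :
  injective v -> exists2 rho, 0 < rho & forall a b, a != b -> 4 * rho <= `|v a - v b|.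
Proof.
move=> vi.
have [c c0 cP] : exists2 c, 0 < c & forall p : T * T, p.1 != p.2 -> c <= `|v p.1 - v p.2|.
  have : forall s : seq (T * T), exists2 c, 0 < c & forall p, p \in s -> p.1 != p.2 -> c <= `|v p.1 - v p.2|.
    elim=> [|p s [c c0 cP]]; first by exists 1.
    case: (eqVneq p.1 p.2) => pp.
      exists c => // q; rewrite inE => /orP[/eqP -> /eqP //|]; exact: cP.
    exists (Num.min c `|v p.1 - v p.2|).
      rewrite lt_min c0 normr_gt0 subr_eq0; apply: contra pp => /eqP /vi ->//.
    move=> q; rewrite inE ge_min => /orP[/eqP ->|qs qq]; first by rewrite lexx orbT.
    by rewrite cP.
  move=> /(_ (enum {: T * T})) [c c0 cP]; exists c => // p; apply: cP.
  by rewrite mem_enum.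
exists (c / 4); first by rewrite divr_gt0.
move=> a b ab; have := cP (a, b) ab => /=; lra.
Qed.

(** Each value is rounded down to a multiple of [1 / Q], and the rank of its index is added as a
    low-order digit in base [S]; this digit makes the numerators distinct. The common denominator
    lets integer independence apply later. *)
Lemma approx_by_distinct_fractions (R : realType) (T : finType) (y : T -> R) (e : R) :
  0 < e -> (forall a, 0 <= y a <= 1) ->
  exists (num : T -> nat) (D : nat), [/\ injective num, (0 < D)%N,
    forall a, (num a <= D)%N & forall a, `|(num a)%:R / D%:R - y a| <= e].
Proof.
move=> e0 y01.
pose Q := (Num.truncn (2 / e)).+1.
have Qe : 2 / Q%:R <= e.
  have : 2 / e < Q%:R := truncnS_gt _.
  by rewrite ltr_pdivrMr // ler_pdivrMr ?ltr0n // mulrC => /ltW.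
pose S := #|T|.+1.
pose q a := Num.truncn (Q%:R * y a).
pose r (a : T) : nat := enum_rank a.
have rS a : (r a < S)%N by exact: ltn_trans (ltn_ord _) _.
have Qy0 a : 0 <= Q%:R * y a by rewrite mulr_ge0 //; case/andP: (y01 a).
have qQ a : (q a <= Q)%N.
  rewrite -(ler_nat R); apply: le_trans (_ : Q%:R * y a <= _).
    by rewrite truncn_le.
  by rewrite ler_piMr //; case/andP: (y01 a).
(* The factor [Q.+1] instead of [Q] keeps the fractions at most 1 even when [q a = Q]; the total
   error stays below [2 / Q]. *)
exists (fun a => q a * S + r a)%N, (Q.+1 * S)%N; split=> //.
- move=> a b /(congr1 (modn^~ S)); rewrite !modnMDl !modn_small ?rS //.
  by move/ord_inj/enum_rank_inj.
- by move=> a; have := qQ a; have := rS a; nia.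
- move=> a; apply: le_trans Qe.
  have Q0 : 0 < Q%:R :> R by rewrite ltr0n.
  have D0 : 0 < (Q.+1 * S)%:R :> R by rewrite ltr0n.
  have -> : (q a * S + r a)%:R / (Q.+1 * S)%:R - y a =
    ((q a * S + r a)%:R * Q%:R - (Q%:R * y a) * (Q.+1 * S)%:R) / (Q%:R * (Q.+1 * S)%:R).
    by field; rewrite !gt_eqF.
  rewrite normrM normfV (gtr0_norm (mulr_gt0 Q0 D0)) ler_pdivrMr ?mulr_gt0 //.
  rewrite mulrA divfK ?gt_eqF //.
  have /andP[qy1 qy2] := truncn_itv (Qy0 a).
  have h1 : (q a)%:R * (Q.+1 * S)%:R <= Q%:R * y a * (Q.+1 * S)%:R by rewrite ler_pM2r.
  have h2 : Q%:R * y a * (Q.+1 * S)%:R <= (q a).+1%:R * (Q.+1 * S)%:R.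
    by rewrite ler_pM2r // ltW.
  rewrite -!natrM in h1 h2 *.
  have h3 : ((q a * S + r a) * Q <= q a * (Q.+1 * S) + 2 * (Q.+1 * S))%N.
    by have := rS a; nia.
  have h4 : ((q a).+1 * (Q.+1 * S) <= (q a * S + r a) * Q + 2 * (Q.+1 * S))%N.
    by have := qQ a; nia.
  rewrite -(ler_nat R) natrD in h3; rewrite -(ler_nat R) natrD in h4.
  by rewrite ler_norml; apply/andP; split; lra.
Qed.

(** A sum of tents with plateau of radius [rho] and support of radius [2 * rho]. The supports do not
    overlap, so at most one term is nonzero at any point and the bound [B] survives the
    summation. *)
Lemma interpolation_at_separated_points (R : realType) (T : finType)
    (v a : T -> R) (rho B : R) :
  0 < rho -> (forall x y, x != y -> 4 * rho <= `|v x - v y|) ->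
  0 <= B -> (forall x, `|a x| <= B) ->
  exists g : R -> R, [/\ continuous g, forall y, `|g y| <= B &
    forall x y, `|y - v x| <= rho -> g y = a x].
Proof.
move=> rho0 sep B0 aB.
pose tent x y := clamp01 (2 - rho^-1 * `|y - v x|).
pose g y := \sum_x a x * tent x y.
have far x y : 2 * rho <= `|y - v x| -> tent x y = 0.
  move=> h; apply: clamp01_le0; rewrite subr_le0 mulrC ler_pdivlMr //.
have gE x y : `|y - v x| < 2 * rho -> g y = a x * tent x y.
  move=> h; rewrite /g (bigD1 x) //= big1 ?addr0 // => z zx.
  rewrite far ?mulr0 //; have := sep _ _ zx.
  rewrite (_ : v z - v x = (y - v x) - (y - v z)); last by ring.
  by have := ler_normB (y - v x) (y - v z); lra.
exists g; split.
- apply: lipschitz_continuous; apply: lipschitz_sum => x; apply: lipschitzZ.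
  have h : lipschitz (fun y : R => `|1 * y + - v x|).
    by apply: lipschitz_comp (lipschitz_norm R) (lipschitz_affine _ _).
  have := lipschitz_comp (lipschitz_clamp01 R)
    (lipschitz_comp (lipschitz_affine (- rho^-1) 2) h).
  rewrite (_ : (fun y => _) = tent x) //; apply: funext => y; rewrite /tent.
  by congr (clamp01 _); rewrite mul1r; ring.
- move=> y; case: (pselect (exists x, `|y - v x| < 2 * rho)) => [[x /gE ->]|ne].
    have /andP[t0 t1] := clamp01_itv (2 - rho^-1 * `|y - v x|).
    rewrite normrM (ger0_norm t0); apply: le_trans (aB x).
    by rewrite ler_piMr.
  rewrite /g big1 ?normr0 // => x _; rewrite far ?mulr0 //.
  by rewrite leNgt; apply/negP => h; apply: ne; exists x.
- move=> x y h; rewrite (gE x); last by lra.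
  rewrite /tent clamp01_ge1 ?mulr1 //.
  have : rho^-1 * `|y - v x| <= 1 by rewrite mulrC ler_pdivrMr // mul1r.
  by lra.
Qed.

(** * Staggered partitions of unity on the unit interval *)

(** Family [k] consists of trapezoids in the variable [t k x], with ramps of width [1 / K]. A point
    misses all plateaus of family [k] only if the fractional part of [t k x] is below [1 / K]; the
    shifts [k / K] allow this for at most one [k]. *)
Lemma shifted_partitions_of_unity (R : realType) (K : nat) (d : R) :
  (0 < K)%N -> 0 < d ->
  exists (L : nat) (p : 'I_K -> 'I_L -> R) (tau : 'I_K -> 'I_L -> R -> R),
  [/\ forall k j, 0 <= p k j <= 1,
      forall k j, lipschitz (tau k j),
      forall k j x, 0 <= tau k j x &
      forall k x, 0 <= x <= 1 -> \sum_j tau k j x = 1] /\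
  (forall k j x, 0 <= x <= 1 -> tau k j x != 0 -> `|x - p k j| <= d) /\
  forall x, 0 <= x <= 1 -> exists k0, forall k, k != k0 -> exists j, tau k j x = 1.
Proof.
move=> K0 d0.
have K0' : 0 < K%:R :> R by rewrite ltr0n.
have K1 : 1 <= K%:R :> R by rewrite ler1n.
pose N := (Num.truncn (2 / d)).+1.
have N0 : 0 < N%:R :> R by rewrite ltr0n.
have Nd : 2 <= d * N%:R.
  have : 2 / d < N%:R := truncnS_gt _.
  by rewrite ltr_pdivrMr // mulrC => /ltW.
(* The added 1 gives [1 <= t k x], so the ramp of index 0 is already complete and the telescoping
   sum of the [tau k j] equals 1. *)
pose t (k : 'I_K) (x : R) := N%:R * x + (k%:R / K%:R + 1).
have k01 (k : 'I_K) : 0 <= (k%:R / K%:R : R) <= 1.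
  by rewrite divr_ge0 //= ler_pdivrMr // mul1r ler_nat ltnW.
have t1 k x : 0 <= x <= 1 -> 1 <= t k x <= N.+2%:R.
  move=> /andP[x0 x1]; have /andP[k0 k1] := k01 k.
  have h0 : 0 <= N%:R * x by rewrite mulr_ge0.
  have h1 : N%:R * x <= N%:R by rewrite ler_piMr.
  by rewrite /t -addn2 natrD; apply/andP; split; lra.
pose s (u : R) := clamp01 (K%:R * u).
have s1 u : 1 <= K%:R * u -> s u = 1 by exact: clamp01_ge1.
have s1' u : 1 <= u -> s u = 1.
  by move=> u1; apply: s1; rewrite (le_trans K1) // ler_peMr // ltW.
have s0 u : u <= 0 -> s u = 0.
  by move=> u0; apply: clamp01_le0; rewrite pmulr_rle0.
pose tau k (j : nat) x := s (t k x - j%:R) - s (t k x - j.+1%:R).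
(* This is the solution of [t k x = j], moved into the unit interval; clamping does not increase its
   distance to points of that interval. *)
pose p (k : 'I_K) (j : nat) : R := clamp01 (N%:R^-1 * (j%:R - (k%:R / K%:R + 1))).
exists N.+3, (fun k j => p k j), (fun k j => tau k j); split; [split|split].
- by move=> k j; exact: clamp01_itv.
- move=> k j.
  have sl (i : nat) : lipschitz (fun x => s (t k x - i%:R)).
    apply: lipschitz_comp (lipschitz_clamp01 R) _; apply: lipschitzZ.
    have := lipschitz_affine N%:R (k%:R / K%:R + 1 - i%:R : R).
    by under [X in lipschitz X -> _]eq_fun do rewrite addrA.
  have := lipschitzD (sl j) (lipschitzZ (-1) (sl j.+1)).
  by under [X in lipschitz X -> _]eq_fun do rewrite mulN1r.
- move=> k j x; rewrite subr_ge0; apply: clamp01_le; rewrite ler_pM2l //.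
  by rewrite lerD2l lerN2 ler_nat.
- move=> k x /(t1 k)/andP[tk1 tkN].
  have -> : \sum_(j < N.+3) tau k j x =
      - \sum_(j < N.+3) (s (t k x - j.+1%:R) - s (t k x - j%:R)).
    by rewrite -sumrN; apply: eq_bigr => j _; rewrite opprB.
  rewrite -(big_mkord xpredT (fun j => s (t k x - j.+1%:R) - s (t k x - j%:R))).
  rewrite telescope_sumr // s0; last by rewrite subr_le0; apply: le_trans tkN _; rewrite ler_nat.
  by rewrite s1' ?sub0r ?opprK // subr0.
- move=> k j x x01 tj.
  have h1 : j%:R <= t k x.
    rewrite leNgt; apply: contra tj => h; rewrite /tau !s0 ?subrr //.
      by rewrite -natr1; lra.
    by rewrite subr_le0 ltW.
  have h2 : t k x <= j%:R + 2.
    rewrite leNgt; apply: contra tj => h; by rewrite /tau !s1' ?subrr // -?natr1; lra.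
  rewrite -(clamp01_id x01) /p; apply: le_trans (clamp01_lip _ _) _.
  have -> : x - N%:R^-1 * (j%:R - (k%:R / K%:R + 1)) = (t k x - j%:R) / N%:R.
    by rewrite /t; field; rewrite !gt_eqF.
  rewrite ger0_norm; last by rewrite divr_ge0 // subr_ge0.
  by rewrite ler_pdivrMr //; lra.
- move=> x x01.
  pose j k := Num.truncn (t k x).
  have jt k : (j k)%:R <= t k x < (j k).+1%:R.
    by apply: truncn_itv; have /andP[? _] := t1 k x x01; lra.
  have good k : 1 <= K%:R * (t k x - (j k)%:R) -> exists i : 'I_N.+3, tau k i x = 1.
    move=> h; have /andP[j1 j2] := jt k; have /andP[_ tN] := t1 k x x01.
    have jN : (j k < N.+3)%N by rewrite -(ltr_nat R) (le_lt_trans j1) // (le_lt_trans tN) // ltr_nat.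
    exists (Ordinal jN); rewrite /tau /= s1 // s0 ?subr0 //.
    by rewrite subr_le0 ltW.
  (* Both quantities lie in [[0, 1)] and differ by an integer, hence coincide; reduction modulo [K]
     then identifies the indices. *)
  have uniq k k' : K%:R * (t k x - (j k)%:R) < 1 -> K%:R * (t k' x - (j k')%:R) < 1 -> k = k'.
    have e i : K%:R * (t i x - (j i)%:R) = K%:R * (N%:R * x + 1) + i%:R - K%:R * (j i)%:R.
      by rewrite /t; field; rewrite gt_eqF.
    have lo i : 0 <= K%:R * (t i x - (j i)%:R).
      by have /andP[j1 _] := jt i; rewrite mulr_ge0 // subr_ge0.
    move: (lo k) (lo k'); rewrite !e => l1 l2 u1 u2.
    have h1 : ((k + K * j k') < (k' + K * j k).+1)%N.
      by rewrite -(ltr_nat R) -natr1 !natrD !natrM; lra.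
    have h2 : ((k' + K * j k) < (k + K * j k').+1)%N.
      by rewrite -(ltr_nat R) -natr1 !natrD !natrM; lra.
    have /(congr1 (modn^~ K)) : (j k' * K + k = j k * K + k')%N by lia.
    by rewrite !modnMDl !modn_small ?ltn_ord // => /ord_inj.
  case: (pselect (exists k, K%:R * (t k x - (j k)%:R) < 1)) => [[k0 hk0]|ne].
    exists k0 => k kk0; apply: good; rewrite leNgt; apply: contra kk0 => h.
    by apply/eqP; exact: uniq.
  exists (Ordinal K0) => k _; apply: good; rewrite leNgt; apply/negP => h.
  by apply: ne; exists k.
Qed.

(** * Integer independence and counting of good indices *)

(** The difference of the two sums is the value at [t] of the integer polynomial with coefficients
    [a i - b i], which must therefore be zero. *)
Lemma transcendental_powers_independent (R : realType) (t : R) (n : nat) :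
  (forall p : {poly int}, (map_poly intr p).[t] = 0 -> p = 0) ->
  forall a b : 'I_n -> nat,
  \sum_(i < n) t ^+ i * (a i)%:R = \sum_(i < n) t ^+ i * (b i)%:R -> a =1 b.
Proof.
move=> tP a b ab i.
pose c (i : 'I_n) : int := (a i)%:Z - (b i)%:Z.
have p0 : \sum_(i < n) (c i)%:P * 'X^i = 0 :> {poly int}.
  apply: tP; rewrite rmorph_sum /= horner_sum.
  rewrite (eq_bigr (fun i : 'I_n => t ^+ i * (a i)%:R - t ^+ i * (b i)%:R)).
    by rewrite sumrB ab subrr.
  move=> j _; rewrite rmorphM /= map_polyC map_polyXn hornerM hornerC hornerXn /=.
  by rewrite /c rmorphB /= mulrC mulrBr.
have /(congr1 (coefp i)) := p0; rewrite /coefp coef0 coef_sum (bigD1 i) //= big1.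
  by rewrite coefCM coefXn eqxx mulr1 addr0 /c => /eqP; rewrite subr_eq0 => /eqP [].
move=> j ji; rewrite coefCM coefXn (_ : (_ == _) = false) ?mulr0 //.
by apply/negbTE; apply: contra ji => /eqP ij; apply/eqP/ord_inj.
Qed.

(** Exactly [n + 1] indices of [G] are kept, so that the shares [a / (n + 1)] add up to [a]; the
    other [n] terms are merely bounded by [B]. *)
Lemma majority_sum_bound (R : realType) (n : nat) (G : {set 'I_(2 * n + 1)})
    (g : 'I_(2 * n + 1) -> R) (a e B : R) :
  (n < #|G|)%N -> (forall k, `|g k| <= B) ->
  (forall k, k \in G -> `|a / n.+1%:R - g k| <= e) ->
  `|a - \sum_k g k| <= n.+1%:R * e + n%:R * B.
Proof.
move=> /card_geqP[s [us ss sG]] gB ge.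
pose S := [set k in s].
have cS : #|S| = n.+1 by rewrite cardsE (card_uniqP us).
have cSC : #|~: S| = n by have := cardsC S; rewrite cS card_ord; lia.
have -> : a - \sum_k g k =
    \sum_(k in S) (a / n.+1%:R - g k) - \sum_(k in ~: S) g k.
  rewrite sumrB sumr_const cS -(mulr_natr (a / _)) divfK ?pnatr_eq0 //.
  rewrite (bigID (mem S)) /= opprD addrA; congr (_ - _ - _).
  by apply: eq_bigl => k; rewrite finset.in_setC.
apply: le_trans (ler_normB _ _) _; apply: lerD.
  apply: le_trans (ler_norm_sum _ _ _) _.
  apply: (@le_trans _ _ (\sum_(k in S) e)).
    by apply: ler_sum => k; rewrite inE => /sG; exact: ge.
  by rewrite sumr_const cS mulr_natl.
apply: le_trans (ler_norm_sum _ _ _) _.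
apply: (@le_trans _ _ (\sum_(k in ~: S) B)); first by apply: ler_sum.
by rewrite sumr_const cSC mulr_natl.
Qed.

(** This count is where [2n + 1] comes from: each of the [n] coordinates spoils one index, and a
    majority of [n + 1] must remain. *)
Lemma card_complement_image (n : nat) (bad : 'I_n -> 'I_(2 * n + 1)) :
  (n < #|~: [set bad i | i in 'I_n]%SET|)%N.
Proof.
have := cardsC [set bad i | i in 'I_n]%SET.
have := leq_imset_card bad 'I_n; rewrite !card_ord.
by move: #|_| #|_| => u w; lia.
Qed.

(** * One stage of the construction: refinement at a given scale *)

Section Stage.
Variables (R : realType) (n : nat) (alpha : 'I_n -> R).
Notation K := (2 * n + 1)%N.
Implicit Types phi psi : 'I_K -> R -> R.

Definition inner_sum psi (k : 'I_K) (x : 'rV[R]_n) : R :=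
  \sum_(i < n) alpha i * psi k (x ord0 i).

Definition contraction : R := (n%:R + 1 / 2) / n.+1%:R.

(* The tolerated oscillation [M / (2 (n + 1))], added to the error
   [n M / (n + 1)] coming from the [n] uncontrolled terms, gives
   [contraction * M]. *)
Definition approximates psi (d : R) :=
  forall (f : 'rV[R]_n -> R) (M : R), 0 < M ->
    (forall x, unit_cube R n x -> `|f x| <= M) ->
    (forall x y, unit_cube R n x -> unit_cube R n y ->
      (forall i, `|x ord0 i - y ord0 i| <= d) ->
      `|f x - f y| <= M / 2 / n.+1%:R) ->
  exists g : R -> R, [/\ continuous g, forall y, `|g y| <= M / n.+1%:R &
    forall x, unit_cube R n x ->
      `|f x - \sum_k g (inner_sum psi k x)| <= contraction * M].

Hypothesis n_gt0 : (0 < n)%N.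
Hypothesis alpha_independent : forall a b : 'I_n -> nat,
  \sum_i alpha i * (a i)%:R = \sum_i alpha i * (b i)%:R -> a =1 b.

(** [phi'] averages distinct fractions close to values of [phi], hence is constant on each plateau.
    The sum with [r'] in the fourth clause places the new tolerance ball inside the old one, as
    nested limits require. *)
Lemma refine_inner_functions phi (r d : R) : 0 < r -> 0 < d ->
  (forall k, lipschitz (phi k)) ->
  (forall k x, 0 <= x <= 1 -> 0 <= phi k x <= 1) ->
  exists phi' r', [/\ forall k, lipschitz (phi' k),
    forall k x, 0 <= x <= 1 -> 0 <= phi' k x <= 1,
    0 < r' <= d,
    forall k x, 0 <= x <= 1 -> `|phi' k x - phi k x| + r' <= r &
    forall psi, (forall k x, 0 <= x <= 1 -> `|psi k x - phi' k x| <= r') ->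
      approximates psi d].
Proof.
move=> r0 d0 /choice[Lk Lip] phi01.
pose Lc := \sum_k Lk k.
have Lc0 : 0 <= Lc by apply: sumr_ge0 => k _; case: (Lip k).
have LipC k x y : `|phi k x - phi k y| <= Lc * `|x - y|.
  have [_ h] := Lip k; apply: le_trans (h x y) _; apply: ler_wpM2r => //.
  by rewrite /Lc (bigD1 k) //= lerDl sumr_ge0 // => j _; case: (Lip j).
(* The mesh is at most [d], to control the oscillation of [f], and so fine that [phi] varies by at
   most [r / 4] over it; another [r / 4] goes to the rounding. *)
pose d1 := Num.min d (r / 4 / (Lc + 1)).
have Lc1 : 0 < Lc + 1 by lra.
have d1_gt0 : 0 < d1 by rewrite lt_min d0 !divr_gt0.
have d1d : d1 <= d by rewrite ge_min lexx.
have d1L : Lc * d1 <= r / 4.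
  have : d1 <= r / 4 / (Lc + 1) by rewrite ge_min lexx orbT.
  by rewrite ler_pdivlMr //; lra.
have K0 : (0 < K)%N by rewrite addn1.
have [L [p [tau [[p01 tauL tau0 tau1] [tau_near tau_good]]]]] :=
  shifted_partitions_of_unity K0 d1_gt0.
have [|a|num [D [num_inj D0 numD numE]]] := @approx_by_distinct_fractions R
  ('I_K * 'I_L)%type (fun a => phi a.1 (p a.1 a.2)) (r / 4).
- by rewrite divr_gt0.
- exact/phi01/p01.
have D0' : 0 < D%:R :> R by rewrite ltr0n.
pose c k j : R := (num (k, j))%:R / D%:R.
have c01 k j : 0 <= c k j <= 1.
  by rewrite divr_ge0 //= ler_pdivrMr // mul1r ler_nat.
pose phi' k x := \sum_j c k j * tau k j x.
(* The value of the inner sum of [phi'] on the product cell with family [a.1] and intervals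
   [a.2]. *)
pose v (a : 'I_K * {ffun 'I_n -> 'I_L}) := \sum_i alpha i * c a.1 (a.2 i).
have v_inj : injective v.
  move=> [k J] [k' J'] /(congr1 (fun s => s * D%:R)); rewrite /v /= !mulr_suml.
  have E (l : 'I_K) (H : {ffun 'I_n -> 'I_L}) i :
      alpha i * c l (H i) * D%:R = alpha i * (num (l, H i))%:R.
    by rewrite /c mulrA divfK // gt_eqF.
  under eq_bigr do rewrite E; under [RHS]eq_bigr do rewrite E.
  move=> /alpha_independent e.
  (* Independence compares one coordinate at a time, so some coordinate must exist to recover
     [k]. *)
  have [ek _] : (k, J (Ordinal n_gt0)) = (k', J' (Ordinal n_gt0)) by exact/num_inj/e.
  congr pair => //; apply/ffunP => i.
  by have [_ ->] : (k, J i) = (k', J' i) by exact/num_inj/e.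
have [rho rho0 sep] := separated_family v_inj.
pose A := \sum_i `|alpha i|.
have A1 : 0 < A + 1 by rewrite ltr_wpDl // sumr_ge0.
(* Half of [r] is left for later changes, and [A * r' <= rho] keeps perturbed inner sums on the
   plateaus of the interpolant; [A + 1] avoids division by zero. *)
pose r' := Num.min (Num.min d (r / 2)) (rho / (A + 1)).
have r'0 : 0 < r' by rewrite !lt_min d0 !divr_gt0.
have r'd : r' <= d by rewrite !ge_min lexx.
have r'r : r' <= r / 2 by rewrite !ge_min lexx orbT.
have r'rho : A * r' <= rho.
  have : r' <= rho / (A + 1) by rewrite !ge_min lexx !orbT.
  by rewrite ler_pdivlMr //; lra.
exists phi', r'; split.
- by move=> k; apply: lipschitz_sum => j; apply: lipschitzZ.
- move=> k x x01; apply/andP; split.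
    by apply: sumr_ge0 => j _; rewrite mulr_ge0 //; case/andP: (c01 k j).
  rewrite -(tau1 k x x01); apply: ler_sum => j _; rewrite ler_piMl //.
  by case/andP: (c01 k j).
- by rewrite r'0.
- move=> k x x01; suff : `|phi' k x - phi k x| <= r / 2 by lra.
  (* As the weights sum to 1, the difference is a weighted mean of [c k j - phi k x], in which only
     points [p k j] close to [x] contribute. *)
  rewrite -[phi k x]mulr1 -(tau1 k x x01) mulr_sumr -sumrB.
  apply: le_trans (ler_norm_sum _ _ _) _.
  apply: (@le_trans _ _ (\sum_j r / 2 * tau k j x)); last first.
    by rewrite -mulr_sumr tau1 // mulr1.
  apply: ler_sum => j _; rewrite -mulrBl normrM (ger0_norm (tau0 _ _ _)).
  have [->|tj] := eqVneq (tau k j x) 0; first by rewrite !mulr0.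
  apply: ler_wpM2r => //.
  have h1 := numE (k, j); rewrite /= -/(c k j) in h1.
  have h2 := LipC k (p k j) x.
  have h3 : Lc * `|p k j - x| <= r / 4.
    by apply: le_trans d1L; rewrite ler_wpM2l // distrC tau_near.
  rewrite (_ : c k j - phi k x =
    (c k j - phi k (p k j)) + (phi k (p k j) - phi k x)); last by ring.
  by apply: le_trans (ler_normD _ _) _; lra.
move=> psi near_psi f M M0 fM fd.
have n1 : 0 < n.+1%:R :> R by rewrite ltr0n.
pose ctr (a : 'I_K * {ffun 'I_n -> 'I_L}) : 'rV[R]_n := \row_i p a.1 (a.2 i).
have ctr_cube a : unit_cube R n (ctr a).
  by move=> i; rewrite mxE /= in_itv /= p01.
have [||g [gc gB gE]] := @interpolation_at_separated_points R _ v
  (fun a => f (ctr a) / n.+1%:R) rho (M / n.+1%:R) rho0 sep.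
- by rewrite divr_ge0 // ltW.
- move=> a; rewrite normrM normfV (gtr0_norm n1) ler_pM2r ?invr_gt0 //.
  exact/fM/ctr_cube.
exists g; split=> // x xc.
have x01 i : 0 <= x ord0 i <= 1 by have := xc i; rewrite /= in_itv.
have /choice[bad badP] i := tau_good _ (x01 i).
have -> : contraction * M =
    n.+1%:R * (M / 2 / n.+1%:R / n.+1%:R) + n%:R * (M / n.+1%:R).
  by rewrite /contraction -natr1; field; rewrite gt_eqF // natr1.
apply: (@majority_sum_bound _ _ (~: [set bad i | i in 'I_n]%SET)).
- exact: card_complement_image.
- by move=> k; exact: gB.
move=> k; rewrite inE => kb.
(* An index that is bad for no coordinate has every coordinate on a plateau, so [x] lies in the cell
   [(k, J)]. *)
have /choice[J JP] : forall i, exists j, tau k j (x ord0 i) = 1.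
  move=> i; apply: badP; apply: contra kb => /eqP ->; exact: imset_f.
rewrite (gE (k, [ffun i => J i])).
  rewrite -mulrBl normrM normfV (gtr0_norm n1) ler_pM2r ?invr_gt0 //.
  apply: fd => // i; rewrite mxE /= ffunE; apply: le_trans d1d.
  by apply: tau_near => //; rewrite JP oner_neq0.
rewrite /inner_sum /v -sumrB; apply: le_trans (ler_norm_sum _ _ _) _.
apply: le_trans r'rho; rewrite /A mulr_suml; apply: ler_sum => i _ /=.
rewrite -mulrBr normrM ffunE; apply: ler_wpM2l => //.
(* One weight equals 1, so the remaining nonnegative weights sum to 0 and vanish. *)
have <- : phi' k (x ord0 i) = c k (J i); last exact: near_psi.
rewrite /phi' (bigD1 (J i)) //= JP mulr1 big1 ?addr0 // => j jJ.
have /eqP := tau1 k _ (x01 i); rewrite (bigD1 (J i)) //= JP -subr_eq0 addrAC subrr add0r.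
rewrite psumr_eq0 => [/allP /(_ j)|//].
by rewrite mem_index_enum jJ => /(_ isT) /eqP ->; rewrite mulr0.
Qed.

End Stage.

(** * Continuous functions on the cube *)

Lemma continuous_sum (R : realType) (T : topologicalType) (I : finType)
    (F : I -> T -> R) :
  (forall i, continuous (F i)) -> continuous (fun x => \sum_i F i x).
Proof.
move=> Fc; elim: (index_enum I) => [|i s IH].
  by under eq_fun do rewrite big_nil; move=> x; exact: cvg_cst.
under eq_fun do rewrite big_cons; move=> x; apply: cvgD; [exact: Fc|exact: IH].
Qed.

Lemma compact_unit_cube (R : realType) (n : nat) : compact (unit_cube R n).
Proof. by apply: (@rV_compact R n (fun=> `[0, 1]%classic)) => _; exact: segment_compact. Qed.

(** Heine-Cantor, through the near-covering form of compactness; closeness is measured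
    coordinatewise to match [approximates]. *)
Lemma unit_cube_uniformly_continuous (R : realType) (n : nat) (f : 'rV[R]_n -> R) (e : R) :
  {within unit_cube R n, continuous f} -> 0 < e ->
  exists2 d, 0 < d & forall x y, unit_cube R n x -> unit_cube R n y ->
    (forall i, `|x ord0 i - y ord0 i| <= d) -> `|f x - f y| <= e.
Proof.
move=> /subspace_continuousP fc e0.
pose P (d : R) (x : 'rV[R]_n) := unit_cube R n x -> forall y, unit_cube R n y ->
  (forall i, `|x ord0 i - y ord0 i| <= d) -> `|f x - f y| <= e.
have cov := (compact_near_coveringP _).1 (@compact_unit_cube R n).
have : \forall d \near 0^'+, unit_cube R n `<=` P d.
  apply: cov => x xc.
  have /cvgrPdist_lt /(_ (e / 2)) := fc x xc.
  rewrite divr_gt0 // => /(_ isT); rewrite /within /= => /nbhs_ballP[r /= r0 hr].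
  exists (ball x (r / 2), [set d : R | d < r / 2]).
    split; first by apply: nbhsx_ballx; rewrite divr_gt0.
    by apply: nbhs_right_lt; rewrite divr_gt0.
  move=> [z d] [/= xz dr] zc y yc zy.
  have fz : `|f x - f z| < e / 2.
    apply: hr => //; split=> // i j; apply: le_ball (xz.2 i j); lra.
  have fy : `|f x - f y| < e / 2.
    apply: hr => //; split=> // i j; rewrite /ball /=; have := xz.2 i j; rewrite /ball /= => h.
    rewrite (_ : x i j - y i j = (x i j - z i j) + (z i j - y i j)); last by ring.
    apply: le_lt_trans (ler_normD _ _) _.
    by have := zy j; rewrite (ord1 i) in h *; lra.
  rewrite (_ : f z - f y = (f x - f y) - (f x - f z)); last by ring.
  by apply: le_trans (ler_normB _ _) _; lra.
move=> cubeP; have : \forall d \near 0^'+, 0 < d /\ unit_cube R n `<=` P d.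
  by near=> d; split; near: d => //; exact: nbhs_right_gt.
by move=> /filter_ex[d [d0 h]]; exists d => // x y xc yc; exact: h.
Unshelve. all: end_near.
Qed.

Lemma unit_cube_bounded (R : realType) (n : nat) (f : 'rV[R]_n -> R) :
  {within unit_cube R n, continuous f} ->
  exists2 M, 0 < M & forall x, unit_cube R n x -> `|f x| <= M.
Proof.
move=> fc; have [M [_ Mb]] := compact_bounded (continuous_compact fc (@compact_unit_cube R n)).
exists (`|M| + 1); first by rewrite ltr_wpDl.
move=> x xc; apply: Mb; last by exists x.
by apply: le_lt_trans (ler_norm M) _; rewrite ltrDl.
Qed.

(** * Passage to the limit in the inner and outer functions *)

Section Superposition.
Variables (R : realType) (n : nat) (alpha : 'I_n -> R).
Notation K := (2 * n + 1)%N.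
Notation theta := (contraction R n).

Lemma contraction_gt0 : 0 < theta.
Proof. by rewrite divr_gt0 // ltr_wpDl. Qed.

Lemma contraction_lt1 : theta < 1.
Proof. by rewrite /contraction ltr_pdivrMr // mul1r -[n.+1%:R]natr1; lra. Qed.

Lemma contraction_pow_small (C e : R) : 0 < e -> exists m, C * theta ^+ m <= e.
Proof.
move=> e0.
have t1 : `|theta| < 1 by rewrite gtr0_norm ?contraction_gt0 // contraction_lt1.
have /cvgr0Pnorm_lt /(_ _ e0) [m _ /(_ m (leqnn m)) h] := @cvg_geometric R C _ t1.
by exists m; apply: le_trans (ler_norm _) (ltW h).
Qed.

(** Refinement is iterated with scales [1 / (m + 1)]. The limit stays in every tolerance ball, so it
    inherits the approximation property at all scales. *)
Lemma approximating_inner_functions : (0 < n)%N ->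
  (forall a b : 'I_n -> nat, \sum_i alpha i * (a i)%:R = \sum_i alpha i * (b i)%:R -> a =1 b) ->
  exists psi : 'I_K -> R -> R, [/\ forall k, continuous (psi k),
    forall k x, 0 <= psi k x <= 1 & forall m : nat, approximates alpha psi m.+1%:R^-1].
Proof.
move=> n0 ind.
pose state := (('I_K -> R -> R) * R)%type.
pose inv (s : state) := [/\ forall k, lipschitz (s.1 k),
  forall k x, 0 <= x <= 1 -> 0 <= s.1 k x <= 1 & 0 < s.2].
pose next (m : nat) (s s' : state) := [/\ s'.2 <= m.+1%:R^-1,
  forall k x, 0 <= x <= 1 -> `|s'.1 k x - s.1 k x| + s'.2 <= s.2 &
  forall psi, (forall k x, 0 <= x <= 1 -> `|psi k x - s'.1 k x| <= s'.2) ->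
    approximates alpha psi m.+1%:R^-1].
have /choice[F FP] : forall ms : nat * state, exists s', inv ms.2 -> inv s' /\ next ms.1 ms.2 s'.
  (* A state violating the invariant returns itself, only to make the choice function total. *)
  move=> [m s]; case: (pselect (inv s)) => [[sl s01 s0]|ns]; last by exists s.
  have m0 : 0 < m.+1%:R^-1 :> R by rewrite invr_gt0.
  have [phi' [r' [h1 h2 /andP[h3 h3'] h4 h5]]] := refine_inner_functions n0 ind s0 m0 sl s01.
  by exists (phi', r').
pose s := fix s m : state := if m is m'.+1 then F (m', s m') else (fun _ _ => 0, 1).
have sinv m : inv (s m).
  elim: m => [|m IH]; last by have [] := FP (m, s m) IH.
  split=> //= [k|k x _]; [exact: lipschitz_cst|by rewrite lexx ler01].
have snext m : next m (s m) (s m.+1) by have [] := FP (m, s m) (sinv m).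
have r0 m : 0 <= (s m).2 by have [_ _ /ltW] := sinv m.
(* The estimates hold on the unit interval only; composing with [clamp01] makes them global. *)
have [h hP] : exists h : 'I_K * R -> R,
    forall m kx, `|h kx - (s m).1 kx.1 (clamp01 kx.2)| <= (s m).2.
  apply: (nested_limit (H := fun m kx => (s m).1 kx.1 (clamp01 kx.2)) r0).
  move=> m [k x]; have [_ + _] := snext m; apply; exact: clamp01_itv.
have small e : 0 < e -> exists m, (s m).2 <= e.
  move=> e0; exists (Num.truncn e^-1).+1.
  have [+ _ _] := snext (Num.truncn e^-1); move=> /le_trans; apply.
  by rewrite invf_ple ?posrE // ltW // truncnS_gt.
exists (fun k x => h (k, x)); split.
- move=> k; apply: uniform_approx_continuous (fun m x => hP m (k, x)) small.
  move=> m x; apply: continuous_comp; last first.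
    by have [/(_ k) /lipschitz_continuous + _ _] := sinv m; apply.
  exact/lipschitz_continuous/lipschitz_clamp01.
- move=> k x.
  have in01 m : - (s m).2 <= h (k, x) <= 1 + (s m).2.
    have := hP m (k, x); rewrite ler_norml /=.
    have [_ /(_ k _ (clamp01_itv x)) + _] := sinv m.
    by move=> /andP[? ?] /andP[? ?]; apply/andP; split; lra.
  apply/andP; split; apply/ler_addgt0Pr => e /small[m sm];
    have /andP[] := in01 m; lra.
- move=> m; have [_ _] := snext m; apply => k x x01.
  by have := hP m.+1 (k, x); rewrite /= clamp01_id.
Qed.

(** Each step subtracts from the remainder [u m] an approximating superposition, shrinking its bound
    by [theta]; the outer functions [g m] form a geometrically convergent series with sum [h]. *)
Lemma superposition (psi : 'I_K -> R -> R) (f : 'rV[R]_n -> R) :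
  (forall k, continuous (psi k)) -> (forall m : nat, approximates alpha psi m.+1%:R^-1) ->
  {within unit_cube R n, continuous f} ->
  exists h : R -> R, continuous h /\
    forall x, unit_cube R n x -> f x = \sum_k h (inner_sum alpha psi k x).
Proof.
move=> psic psiA fc.
have n1 : 0 < n.+1%:R :> R by rewrite ltr0n.
have t0 := contraction_gt0; have t1 := contraction_lt1.
have [M M0 fM] := unit_cube_bounded fc.
pose S (g : R -> R) x := \sum_k g (inner_sum alpha psi k x).
have Sc g : continuous g -> continuous (S g).
  move=> gc; apply: continuous_sum => k x; apply: (@continuous_comp _ _ _ (inner_sum alpha psi k) g); last exact: gc.
  move: x; apply: continuous_sum => i x; apply: continuousM; first exact: cst_continuous.
  by apply: (@continuous_comp _ _ _ (fun x : 'rV[R]_n => x ord0 i) (psi k));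
    [exact: coord_continuous|exact: psic].
pose inv m (u : 'rV[R]_n -> R) := {within unit_cube R n, continuous u} /\
  forall x, unit_cube R n x -> `|u x| <= M * theta ^+ m.
have /choice[G GP] : forall mu : nat * ('rV[R]_n -> R), exists g, inv mu.1 mu.2 ->
    [/\ continuous g, forall y, `|g y| <= M * theta ^+ mu.1 / n.+1%:R &
      inv mu.1.+1 (fun x => mu.2 x - S g x)].
  move=> [m u]; case: (pselect (inv m u)) => [[/= uc uM]|nu]; last by exists 0.
  have Mm0 : 0 < M * theta ^+ m by rewrite mulr_gt0 // exprn_gt0.
  have e0 : 0 < M * theta ^+ m / 2 / n.+1%:R by rewrite !divr_gt0.
  have [d d0 ud] := unit_cube_uniformly_continuous uc e0.
  (* The index [truncn d^-1] gives a scale [1 / (m + 1)] at most [d]. *)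
  have [|g [gc gM gS]] := psiA (Num.truncn d^-1) u _ Mm0 uM.
    move=> x y xc yc xy; apply: ud => // i; apply: le_trans (xy i) _.
    by rewrite invf_ple ?posrE // ltW // truncnS_gt.
  exists g => _; split=> //; split; last first.
    by move=> x xc; rewrite exprS mulrCA; exact: gS.
  move=> x; apply: continuousB; first exact: uc.
  by apply: continuous_subspaceT; exact: Sc.
pose u := fix u m : 'rV[R]_n -> R :=
  if m is m'.+1 then (fun x => u m' x - S (G (m', u m')) x) else f.
pose g m := G (m, u m).
have uinv m : inv m (u m).
  elim: m => [|m IH]; last by have [] := GP (m, u m) IH.
  by split=> // x; rewrite expr0 mulr1; exact: fM.
have gP m : continuous (g m) /\ forall y, `|g m y| <= M * theta ^+ m / n.+1%:R.
  by have [] := GP (m, u m) (uinv m).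
pose H m y := \sum_(j < m) g j y.
have Hc m : continuous (H m) by apply: continuous_sum => j; have [] := gP j.
have uE m x : f x - S (H m) x = u m x.
  elim: m => [|m IH] /=.
    rewrite /S /H big1 ?subr0 // => k _; by rewrite big_ord0.
  rewrite -IH -addrA -opprD; congr (_ - _); rewrite /S -big_split.
  by apply: eq_bigr => k _; rewrite /H big_ord_recr.
(* [C * theta ^+ m] is the tail from [m] of the geometric series bounding the [g j], so the nesting
   condition holds with equality. *)
pose C := M / n.+1%:R / (1 - theta).
have C0 : 0 < C by rewrite !divr_gt0 // subr_gt0.
have [||h hH] := nested_limit (H := H) (r := fun m => C * theta ^+ m).
- by move=> m; rewrite mulr_ge0 // ltW // exprn_gt0.
- move=> m y; rewrite {1}/H big_ord_recr /= -/(H m y) addrAC subrr add0r.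
  have [_ /(_ y) gy] := gP m; apply: le_trans (lerD gy (lexx _)) _.
  rewrite /C exprS le_eqVlt; apply/orP; left; apply/eqP.
  by field; rewrite subr_eq0 !gt_eqF.
exists h; split.
  by apply: uniform_approx_continuous Hc hH _ => e; exact: contraction_pow_small.
move=> x xc; apply/eqP; rewrite -subr_eq0 -normr_le0; apply/ler_addgt0Pr => e e0.
rewrite add0r.
(* [M] accounts for the remainder [u m], and [K * C] for replacing [h] by [H m] in the [K] terms. *)
have [m me] := contraction_pow_small (M + K%:R * C) e0.
apply: le_trans me; rewrite mulrDl.
rewrite -/(S h x) (_ : f x - S h x = u m x - \sum_k
  (h (inner_sum alpha psi k x) - H m (inner_sum alpha psi k x))); last first.
  by rewrite -uE sumrB -/(S h x) -/(S (H m) x); ring.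
apply: le_trans (ler_normB _ _) _; apply: lerD; first by have [_] := uinv m; apply.
apply: le_trans (ler_norm_sum _ _ _) _.
apply: (@le_trans _ _ (\sum_(k < K) C * theta ^+ m)).
  by apply: ler_sum => k _; exact: hH.
by rewrite sumr_const card_ord mulr_natl mulrnAl.
Qed.

End Superposition.

(** * Powers of a transcendental number as weights *)

Theorem mainTheorem1 (R : realType) (n : nat) (n_gt1 : (1 < n)%N) :
  exists (alpha : 'I_n -> R) (phi : 'I_(2 * n + 1) -> R -> R),
    (forall k, {within `[0, 1], continuous (phi k)} /\
               set_fun `[0, 1] `[0, 1] (phi k)) /\
    forall f : 'rV[R]_n -> R, {within unit_cube R n, continuous f} ->
      exists h : R -> R, continuous h /\
        forall x : 'rV[R]_n, unit_cube R n x ->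
          f x = \sum_(k < 2 * n + 1) h (\sum_(i < n) alpha i * phi k (x ord0 i)).
Proof.
have [t tP] := exists_transcendental R.
have [psi [psic psi01 psiA]] :=
  approximating_inner_functions (ltnW n_gt1) (transcendental_powers_independent tP).
exists (fun i => t ^+ i), psi; split.
  move=> k; split; first exact/continuous_subspaceT/psic.
  by move=> x _; rewrite /= in_itv /= psi01.
by move=> f; exact: superposition psic psiA.
Qed.
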